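(* The $(q,r)$-Eulerian polynomials satisfy $A_1(t,r,q)=r$ and, for all $n\ge 1$, $$A_{n+1}(t,r,q)=rA_n(t,r,q)+tA_n(t,q)+t\sum_{j=1}^{n-1}{n\brack j}_q q^j A_j(t,r,q)A_{n-j}(t,q).$$
   Context: Notation: $(q;q)_n=\prod_{i=1}^n(1-q^i)$, $(q;q)_0=1$; $e(z;q)=\sum_{n\ge 0}\frac{z^n}{(q;q)_n}$; ${n\brack k}_q=\frac{(q;q)_n}{(q;q)_{n-k}(q;q)_k}$ for $0\le k\le n$, and $0$ otherwise. The $(q,r)$-Eulerian polynomials $A_n(t,r,q)$, $n\ge 0$, are defined by the identity of formal power series in $z$ $$\sum_{n\ge 0}A_n(t,r,q)\frac{z^n}{(q;q)_n}=\frac{(1-t)e(rz;q)}{e(tz;q)-te(z;q)},$$ and $A_n(t,q):=A_n(t,1,q)$. *)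

(* Defs.v *)
From HB Require Import structures.
From mathcomp Require Import all_boot all_order all_algebra.
Set Implicit Arguments.
Unset Strict Implicit.
Unset Printing Implicit Defensive.
Import GRing.Theory.
Local Open Scope ring_scope.

(* The parameters t, r, q are elements of an arbitrary field F.  The formal
   identities in indeterminates are the case F = Q(t, r, q).  Everything below
   is meaningful when t != 1 and q ^+ i != 1 for all i > 0; the indeterminates
   satisfy both conditions. *)

Definition qpoch (F : fieldType) (q : F) (n : nat) : F :=
  \prod_(1 <= i < n.+1) (1 - q ^+ i).

Definition qbinom (F : fieldType) (q : F) (n k : nat) : F :=
  if (k <= n)%N then qpoch q n / (qpoch q (n - k) * qpoch q k) else 0.

(* A formal power series in z is its sequence of coefficients. *)
Definition fps (F : fieldType) : Type := nat -> F.

Definition fps_sub (F : fieldType) (f g : fps F) : fps F :=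
  fun n => f n - g n.

Definition fps_scale (F : fieldType) (c : F) (f : fps F) : fps F :=
  fun n => c * f n.

Definition fps_mul (F : fieldType) (f g : fps F) : fps F :=
  fun n => \sum_(i < n.+1) f i * g (n - i)%N.

Definition fps_one (F : fieldType) : fps F := fun n => (n == 0%N)%:R.

(* The first n coefficients of the inverse g of f, for f 0 != 0, from
   g 0 = 1 / f 0 and g m = - (\sum_(i < m) f (m - i) * g i) / f 0. *)
Fixpoint fps_inv_seq (F : fieldType) (f : fps F) (n : nat) : seq F :=
  if n is m.+1 then
    let s := fps_inv_seq f m in
    rcons s (((m == 0%N)%:R - \sum_(i < m) f (m - i)%N * s`_i) / f 0%N)
  else [::].

Definition fps_inv (F : fieldType) (f : fps F) : fps F :=
  fun n => (fps_inv_seq f n.+1)`_n.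

Definition fps_div (F : fieldType) (f g : fps F) : fps F :=
  fps_mul f (fps_inv g).

(* The series e(c z; q) in z. *)
Definition qexp (F : fieldType) (c q : F) : fps F :=
  fun n => c ^+ n / qpoch q n.

(* A_n(t, r, q): the coefficient of z^n / (q; q)_n in
   (1 - t) e(r z; q) / (e(t z; q) - t e(z; q)). *)
Definition qrEulerian (F : fieldType) (n : nat) (t r q : F) : F :=
  qpoch q n *
  fps_div (fps_scale (1 - t) (qexp r q))
          (fps_sub (qexp t q) (fps_scale t (qexp 1 q))) n.

Definition qEulerian (F : fieldType) (n : nat) (t q : F) : F :=
  qrEulerian n t 1 q.

Lemma size_fps_inv_seq (F : fieldType) (f : fps F) n :
  size (fps_inv_seq f n) = n.
Proof. by elim: n => //= n IHn; rewrite size_rcons IHn. Qed.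

Lemma nth_fps_inv_seq (F : fieldType) (f : fps F) n i :
  (i < n)%N -> (fps_inv_seq f n)`_i = fps_inv f i.
Proof.
elim: n => // n IHn; rewrite ltnS leq_eqVlt => /orP[/eqP -> //|lt_in].
by rewrite /= nth_rcons size_fps_inv_seq lt_in IHn.
Qed.

Lemma fps_invE (F : fieldType) (f : fps F) n :
  fps_inv f n =
  ((n == 0%N)%:R - \sum_(i < n) f (n - i)%N * fps_inv f i) / f 0%N.
Proof.
rewrite {1}/fps_inv /= nth_rcons size_fps_inv_seq ltnn eqxx.
by under eq_bigr => i _ do rewrite nth_fps_inv_seq //.
Qed.

Lemma fps_mulVf (F : fieldType) (f : fps F) :
  f 0%N != 0 -> fps_mul (fps_inv f) f =1 @fps_one F.
Proof.
move=> f0 n; rewrite /fps_mul big_ord_recr /= subnn fps_invE divfK //.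
under eq_bigr => i _ do rewrite mulrC.
by rewrite addrC subrK.
Qed.

Lemma fps_mulA (F : fieldType) (f g h : fps F) :
  fps_mul f (fps_mul g h) =1 fps_mul (fps_mul f g) h.
Proof.
move=> n; have cf (u v : fps F) m : (m <= n)%N ->
    fps_mul u v m = ((\poly_(i < n.+1) u i) * (\poly_(i < n.+1) v i))`_m.
  move=> le_mn; rewrite coefM; apply: eq_bigr => i _.
  have le_in : (i <= n)%N by apply: leq_trans le_mn; rewrite -ltnS.
  by rewrite !coef_poly !ltnS le_in (leq_trans (leq_subr _ _) le_mn).
transitivity ((\poly_(i < n.+1) f i *
               (\poly_(i < n.+1) g i * \poly_(i < n.+1) h i))`_n).
  rewrite coefM; apply: eq_bigr => i _.
  by rewrite coef_poly ltn_ord cf ?leq_subr.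
rewrite mulrA coefM; apply: eq_bigr => i _.
by rewrite coef_poly ltnS leq_subr cf // -ltnS.
Qed.

Lemma qpoch_neq0 (F : fieldType) (q : F) n :
  (forall i, (0 < i)%N -> q ^+ i != 1) -> qpoch q n != 0.
Proof.
move=> hq; rewrite /qpoch big_nat.
elim/big_ind: _ => [|x y x0 y0|i /andP[i_gt0 _]]; first exact: oner_neq0.
  by rewrite mulf_neq0.
by rewrite subr_eq0 eq_sym hq.
Qed.

(* The defining identity, with the denominator cleared. *)
Lemma qrEulerian_gf (F : fieldType) (t r q : F) :
    t != 1 -> (forall i, (0 < i)%N -> q ^+ i != 1) ->
  fps_mul (fun n => qrEulerian n t r q / qpoch q n)
          (fps_sub (qexp t q) (fps_scale t (qexp 1 q)))
    =1 fps_scale (1 - t) (qexp r q).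
Proof.
move=> ht hq n; set D := fps_sub _ _; set N := fps_scale _ _.
have D0 : D 0%N != 0.
  rewrite /D /fps_sub /fps_scale /qexp /qpoch big_geq // !expr0 invr1 !mulr1.
  by rewrite subr_eq0 eq_sym.
transitivity (fps_mul (fps_mul N (fps_inv D)) D n).
  apply: eq_bigr => i _; congr (_ * _).
  by rewrite /qrEulerian mulrC mulKf // qpoch_neq0.
rewrite -fps_mulA /fps_mul big_ord_recr /= subnn.
rewrite -!/(fps_mul (fps_inv D) D _) fps_mulVf // mulr1 big1 ?add0r // => i _.
rewrite -/(fps_mul (fps_inv D) D _) fps_mulVf //.
by rewrite /fps_one subn_eq0 leqNgt ltn_ord mulr0.
Qed.

(* Main.v *)
Require Import Defs.
From HB Require Import structures.
From mathcomp Require Import all_boot all_order all_algebra.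
From mathcomp Require Import ring.
Set Implicit Arguments.
Unset Strict Implicit.
Unset Printing Implicit Defensive.
Import GRing.Theory.
Local Open Scope ring_scope.

(** Write a(z) for the generating series of the A_n(t, r, q) / (q; q)_n, g(z)
for its specialization at r = 1, and D(z) = e(tz; q) - t e(z; q), so that
a D = (1 - t) e(rz; q) and g D = (1 - t) e(z; q).  The recurrence is the
coefficient form of a first order q-differential equation for a.  Let
(delta f)(z) = (f(z) - f(qz)) / z.  This operator satisfies the twisted
Leibniz rule delta (f h) = (delta f) h + f(qz) (delta h) ([qdiff_mul]), and
e(cz; q) is an eigenvector of it with eigenvalue c ([qdiff_qexp]).  Hence
  delta D = t (e(tz; q) - e(z; q)) = t (D - (1 - t) e(z; q)) = t (1 - g) D
([qdiff_denom]); applying delta to a D = (1 - t) e(rz; q) gives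
  r a D = (delta a) D + t a(qz) (1 - g) D.
As D(0) = 1 - t is not zero, D can be cancelled ([fps_mulIf]), leaving
  delta a = r a + t a(qz) (g - 1)
([qrEulerian_qdiff]).  Since g(0) = 1, the coefficient of z^n in a(qz) (g - 1)
involves only the a_j with j < n.  Multiplying the coefficient of z^n by
(q; q)_n gives the recurrence; its term for j = 0 is t A_n(t, q). *)

(** * Formal power series *)

Lemma eq_fps_mulr (F : fieldType) (f g h : fps F) :
  g =1 h -> fps_mul f g =1 fps_mul f h.
Proof. by move=> gh n; apply: eq_bigr => i _; rewrite gh. Qed.

Lemma fps_mulBl (F : fieldType) (f g h : fps F) n :
  fps_mul (fps_sub f g) h n = fps_mul f h n - fps_mul g h n.
Proof. by rewrite -sumrB; apply: eq_bigr => i _; rewrite mulrBl. Qed.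

Lemma fps_mulZl (F : fieldType) (c : F) (f g : fps F) n :
  fps_mul (fps_scale c f) g n = c * fps_mul f g n.
Proof. by rewrite mulr_sumr; apply: eq_bigr => i _; rewrite mulrA. Qed.

Lemma fps_mul1f (F : fieldType) (f : fps F) : fps_mul (@fps_one F) f =1 f.
Proof.
move=> n; rewrite /fps_mul big_ord_recl /= subn0 mul1r big1 ?addr0 // => i _.
by rewrite /fps_one mul0r.
Qed.

Lemma fps_mulIf (F : fieldType) (h f g : fps F) :
  h 0%N != 0 -> fps_mul f h =1 fps_mul g h -> f =1 g.
Proof.
move=> h0 fgh n; elim/ltn_ind: n => n IHn.
have := fgh n; rewrite /fps_mul !big_ord_recr /= subnn.
under eq_bigr => i _ do rewrite IHn //.
by move/addrI/(mulIf h0).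
Qed.

(** * The q-difference operator *)

Definition fps_dilate (F : fieldType) (q : F) (f : fps F) : fps F :=
  fun n => q ^+ n * f n.

(** The series (f(z) - f(qz)) / z, that is, 1 - q times the Jackson derivative
of f. *)
Definition qdiff (F : fieldType) (q : F) (f : fps F) : fps F :=
  fun n => (1 - q ^+ n.+1) * f n.+1.

(** On the products f_i h_j with i + j = n + 1, this is the identity
1 - q^(i+j) = (1 - q^i) + q^i (1 - q^j). *)
Lemma qdiff_mul (F : fieldType) (q : F) (f h : fps F) n :
  qdiff q (fps_mul f h) n =
  fps_mul (qdiff q f) h n + fps_mul (fps_dilate q f) (qdiff q h) n.
Proof.
transitivity (\sum_(i < n.+2) (1 - q ^+ i) * f i * h (n.+1 - i)%N +
   \sum_(i < n.+2) q ^+ i * f i * ((1 - q ^+ (n.+1 - i)) * h (n.+1 - i)%N)).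
  rewrite /qdiff /fps_mul -big_split mulr_sumr; apply: eq_bigr => i _ /=.
  have -> : q ^+ n.+1 = q ^+ i * q ^+ (n.+1 - i).
    by rewrite -exprD subnKC // -ltnS.
  by ring.
(* The factors 1 - q^i and 1 - q^j kill the extreme terms i = 0 and j = 0. *)
congr (_ + _).
  rewrite big_ord_recl expr0 subrr !mul0r add0r.
  by apply: eq_bigr => i _; rewrite /= subSS.
rewrite big_ord_recr /= subnn expr0 subrr mul0r mulr0 addr0.
by apply: eq_bigr => i _; rewrite /qdiff subSn // -ltnS.
Qed.

Lemma qpochS (F : fieldType) (q : F) n :
  qpoch q n.+1 = qpoch q n * (1 - q ^+ n.+1).
Proof. by rewrite /qpoch big_nat_recr. Qed.

Lemma qpoch0 (F : fieldType) (q : F) : qpoch q 0 = 1.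
Proof. by rewrite /qpoch big_geq. Qed.

Lemma qdiff_qexp (F : fieldType) (c q : F) :
    (forall i, (0 < i)%N -> q ^+ i != 1) ->
  qdiff q (qexp c q) =1 fps_scale c (qexp c q).
Proof.
move=> hq n; have qn := qpoch_neq0 n hq.
have q1 : 1 - q ^+ n.+1 != 0 by rewrite subr_eq0 eq_sym hq.
by rewrite /qdiff /fps_scale /qexp qpochS (exprS c); field; rewrite qn.
Qed.

(** * The q-differential equation of the generating series *)

Definition qrEulerian_gs (F : fieldType) (t r q : F) : fps F :=
  fun n => qrEulerian n t r q / qpoch q n.

Definition qrEulerian_denom (F : fieldType) (t q : F) : fps F :=
  fps_sub (qexp t q) (fps_scale t (qexp 1 q)).

Lemma qrEulerian_denom0 (F : fieldType) (t q : F) :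
  qrEulerian_denom t q 0%N = 1 - t.
Proof.
by rewrite /qrEulerian_denom /fps_sub /fps_scale /qexp qpoch0 !divr1 mulr1.
Qed.

Lemma qrEulerian_gs0 (F : fieldType) (t r q : F) :
    t != 1 -> (forall i, (0 < i)%N -> q ^+ i != 1) ->
  qrEulerian_gs t r q 0%N = 1.
Proof.
move=> ht hq; have t1 : 1 - t != 0 by rewrite subr_eq0 eq_sym.
have := qrEulerian_gf r ht hq 0%N; rewrite -/(qrEulerian_denom t q).
rewrite /fps_mul big_ord1 subn0 qrEulerian_denom0 /fps_scale /qexp.
by rewrite /qrEulerian_gs qpoch0 !divr1 mulrC => /(mulfI t1).
Qed.

(** Since D = e(tz; q) - t e(z; q), the difference e(tz; q) - e(z; q) is
D - (1 - t) e(z; q), and (1 - t) e(z; q) is g D by the definition of g: this is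
how the series for r = 1 enters the recurrence for general r. *)
Lemma qdiff_denom (F : fieldType) (t q : F) (D := qrEulerian_denom t q) :
    t != 1 -> (forall i, (0 < i)%N -> q ^+ i != 1) ->
  qdiff q D =1
  fps_mul (fps_scale t (fps_sub (@fps_one F) (qrEulerian_gs t 1 q))) D.
Proof.
move=> ht hq n; rewrite fps_mulZl fps_mulBl fps_mul1f (qrEulerian_gf 1 ht hq n).
have := qdiff_qexp t hq n; have := qdiff_qexp 1 hq n.
rewrite /D /qrEulerian_denom /qdiff /fps_sub /fps_scale => e1 et.
by rewrite mulrBr et [X in _ - X = _]mulrCA e1; ring.
Qed.

Lemma qrEulerian_qdiff (F : fieldType) (t r q : F)
    (a := qrEulerian_gs t r q) (g := qrEulerian_gs t 1 q) :
    t != 1 -> (forall i, (0 < i)%N -> q ^+ i != 1) ->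
  qdiff q a =1
  fps_sub (fps_scale r a)
    (fps_mul (fps_dilate q a) (fps_scale t (fps_sub (@fps_one F) g))).
Proof.
move=> ht hq; set w := fps_scale t _; set D := qrEulerian_denom t q.
apply: (@fps_mulIf _ D).
  by rewrite /D qrEulerian_denom0 subr_eq0 eq_sym.
have aD : fps_mul a D =1 fps_scale (1 - t) (qexp r q) := qrEulerian_gf r ht hq.
move=> n; rewrite fps_mulBl fps_mulZl -fps_mulA.
rewrite -(eq_fps_mulr _ (qdiff_denom ht hq)).
apply/eqP; rewrite eq_sym subr_eq -qdiff_mul aD /qdiff aD; apply/eqP.
have := qdiff_qexp r hq n; rewrite /qdiff /fps_scale => er.
by rewrite mulrCA [RHS]mulrCA er.
Qed.

(** * The recurrence *)

(** Keeping the summand for j = 0, which is A_n(t, q), inside the sum makes the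
recurrence valid for n = 0 as well, where it gives A_1. *)
Lemma qrEulerian_rec (F : fieldType) (t r q : F) n :
    t != 1 -> (forall i, (0 < i)%N -> q ^+ i != 1) ->
  qrEulerian n.+1 t r q =
    r * qrEulerian n t r q
    + t * \sum_(0 <= j < n)
            qbinom q n j * q ^+ j * qrEulerian j t r q * qEulerian (n - j) t q.
Proof.
move=> ht hq; have qp m : qpoch q m != 0 := qpoch_neq0 m hq.
have q1 : 1 - q ^+ n.+1 != 0 by rewrite subr_eq0 eq_sym hq.
have := qrEulerian_qdiff r ht hq n.
rewrite /qdiff /fps_sub /fps_scale /fps_mul big_ord_recr /= subnn.
(* The constant term 1 - g(0) vanishes, so the last summand drops. *)
rewrite qrEulerian_gs0 // /fps_one eqxx subrr !mulr0 addr0.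
move/(congr1 (fun x => qpoch q n * x)); rewrite /qrEulerian_gs qpochS.
have -> : qpoch q n * ((1 - q ^+ n.+1) * (qrEulerian n.+1 t r q /
    (qpoch q n * (1 - q ^+ n.+1)))) = qrEulerian n.+1 t r q.
  by rewrite mulrA mulrC divfK // mulf_neq0.
move=> ->; rewrite mulrBr; congr (_ + _); first by field.
rewrite mulr_sumr -sumrN big_mkord mulr_sumr; apply: eq_bigr => i _.
rewrite subn_eq0 leqNgt ltn_ord /= /fps_dilate /qbinom ltnW // /qEulerian.
by field; rewrite !qp.
Qed.

Theorem theorem2 (F : fieldType) (t r q : F)
    (ht : t != 1) (hq : forall i : nat, (0 < i)%N -> q ^+ i != 1) :
  qrEulerian 1 t r q = r /\
  (forall n : nat, (1 <= n)%N ->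
    qrEulerian n.+1 t r q =
      r * qrEulerian n t r q + t * qEulerian n t q
      + t * \sum_(1 <= j < n)
              qbinom q n j * q ^+ j * qrEulerian j t r q
                * qEulerian (n - j) t q).
Proof.
have A0 : qrEulerian 0 t r q = 1.
  by have := qrEulerian_gs0 r ht hq; rewrite /qrEulerian_gs qpoch0 divr1.
split; first by rewrite qrEulerian_rec // big_geq // A0 mulr0 addr0 mulr1.
move=> n n_gt0; rewrite qrEulerian_rec // big_ltn // mulrDr addrA.
rewrite A0 expr0 subn0 /qbinom subn0 qpoch0 leq0n !mulr1.
by rewrite divff ?qpoch_neq0 // !mul1r.
Qed.
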